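(* Let $X$ be an infinite set and let $\mathcal{Z}\subseteq\mathcal{P}(X)$ be closed under finite unions with $[X]^{<\omega}\subseteq\mathcal{Z}$. Let $\mathcal{A}$ be a family of subsets of $X$ such that $\emptyset\in\mathcal{A}$ and every singleton of $X$ belongs to $\mathcal{A}$. Then (in $\mathbf{ZF}$): (i) If $\mathcal{Z}$ is a bornology on $X$ such that $\mathbf{S}_{\mathcal{A}}(X,\mathcal{Z})$ is a $P$-space, then $\mathcal{Z}$ is a $\sigma$-ideal. (ii) If both $\mathcal{Z}$ and $\mathcal{A}$ are bornologies on $X$ with $\mathcal{A}\subseteq\mathcal{Z}$, then the following are equivalent: (a) $\mathbf{S}_{\mathcal{A}}(X,\mathcal{Z})$ is a $P$-space; (b) $\mathbf{S}_{\mathcal{A}}(X,\mathcal{Z})$ has a $P$-point; (c) $\emptyset$ is a $P$-point of $\mathbf{S}_{\mathcal{A}}(X,\mathcal{Z})$. (iii) If $\mathcal{Z}=\mathcal{P}(X)$ and $[X]^{<\omega}\subseteq\mathcal{A}$, then $\mathbf{S}_{\mathcal{A}}(X,\mathcal{Z})$ is a $P$-space. (iv) If $\mathcal{Z}$ is a bornology on $X$, then $\mathbf{S}_{\mathcal{P}}(X,\mathcal{Z})$ is a $P$-space if and only if $\emptyset$ is a $P$-point of $\mathbf{S}_{\mathcal{P}}(X,\mathcal{Z})$.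
   Context: The background theory is $\mathbf{ZF}$ (no axiom of choice). $[X]^{<\omega}$ is the set of finite subsets of $X$. For $\mathcal{A}\subseteq\mathcal{P}(X)$, $\mathbf{S}_{\mathcal{A}}(X,\mathcal{Z})$ is the set $\mathcal{A}$ with the topology $\tau_{\mathcal{A}}[\mathcal{Z}]$ consisting of all $V\subseteq\mathcal{A}$ such that for every $x\in V$ there is $z\in\mathcal{Z}$ with $x\cap z=\emptyset$ and $\{y\in\mathcal{A}:x\subseteq y\subseteq X\setminus z\}\subseteq V$. $\mathbf{S}_{\mathcal{P}}(X,\mathcal{Z})=\mathbf{S}_{\mathcal{P}(X)}(X,\mathcal{Z})$. A bornology on $X$ is an ideal $\mathcal{I}$ of subsets of $X$ (closed under subsets and finite unions, possibly improper) with $\bigcup\mathcal{I}=X$. A $\sigma$-ideal is an ideal closed under unions $\bigcup_{n\in\omega}t_n$ of sequences of its members. A point $x$ of a topological space is a $P$-point if $x$ is in the interior of every $G_\delta$-set (countable intersection of open sets) containing $x$; a space is a $P$-space if all its points are $P$-points. *)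

(* Defs.v *)
(** First-order Zermelo-Fraenkel set theory without choice, through its models.

    A theorem of ZF is a sentence true in every model of ZF, so the development
    is carried out inside an arbitrary first-order model.  Stating it about
    Rocq types and predicates instead would interpret it in the ambient logic,
    where the usual classical axioms already imply the axiom of choice.  For
    the same reason Separation and Replacement range over first-order formulas
    with parameters only: if they ranged over all Rocq predicates, choice in
    the ambient logic would give choice in the model. *)

Set Implicit Arguments.
Unset Strict Implicit.

(** Formulas in the language of set theory, with de Bruijn indices. *)
Inductive formula : Set :=
| fMem (i j : nat)
| fEq (i j : nat)
| fBot
| fImp (p q : formula)
| fAnd (p q : formula)
| fOr (p q : formula)
| fAll (p : formula)
| fEx (p : formula).

Definition scons (V : Type) (x : V) (e : nat -> V) (n : nat) : V :=
  match n with 0 => x | S k => e k end.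

Fixpoint sat (V : Type) (E : V -> V -> Prop) (e : nat -> V) (p : formula)
  : Prop :=
  match p with
  | fMem i j => E (e i) (e j)
  | fEq i j => e i = e j
  | fBot => False
  | fImp q r => sat E e q -> sat E e r
  | fAnd q r => sat E e q /\ sat E e r
  | fOr q r => sat E e q \/ sat E e r
  | fAll q => forall x, sat E (scons x e) q
  | fEx q => exists x, sat E (scons x e) q
  end.

(** The constants and operations [empty], [pair], [union], [power] and [omega]
    are uniquely determined by their axioms and extensionality, so this is a
    definitional extension of ZF; they do not occur in [formula]. *)
Record zf_model : Type := {
  carrier :> Type;
  mem : carrier -> carrier -> Prop;
  empty : carrier;
  pair : carrier -> carrier -> carrier;
  union : carrier -> carrier;
  power : carrier -> carrier;
  omega : carrier;
  extensionality : forall x y, (forall u, mem u x <-> mem u y) -> x = y;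
  foundation : forall x, (exists u, mem u x) ->
    exists u, mem u x /\ ~ (exists w, mem w u /\ mem w x);
  empty_spec : forall u, ~ mem u empty;
  pair_spec : forall x y u, mem u (pair x y) <-> u = x \/ u = y;
  union_spec : forall x u, mem u (union x) <-> exists w, mem w x /\ mem u w;
  power_spec : forall x u,
    mem u (power x) <-> (forall w, mem w u -> mem w x);
  omega_zero : mem empty omega;
  omega_succ : forall n, mem n omega -> mem (union (pair n (pair n n))) omega;
  omega_least : forall w, mem empty w ->
    (forall n, mem n w -> mem (union (pair n (pair n n))) w) ->
    forall n, mem n omega -> mem n w;
  separation : forall (p : formula) (e : nat -> carrier) (a : carrier),
    exists b, forall u, mem u b <-> mem u a /\ sat mem (scons u e) p;
  replacement : forall (p : formula) (e : nat -> carrier) (a : carrier),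
    (forall u v v', mem u a ->
       sat mem (scons u (scons v e)) p ->
       sat mem (scons u (scons v' e)) p -> v = v') ->
    exists b, forall v,
      mem v b <-> exists u, mem u a /\ sat mem (scons u (scons v e)) p
}.

Arguments empty {z}.
Arguments omega {z}.

Declare Scope zf_scope.
Delimit Scope zf_scope with zf.
Open Scope zf_scope.

Notation "u ∈ x" := (mem u x) (at level 70, no associativity) : zf_scope.
Notation "u ∉ x" := (~ mem u x) (at level 70, no associativity) : zf_scope.

(** Every quantifier below, including those over sequences, ranges over
    elements of the model [M]. *)
Section InternalNotions.

Variable M : zf_model.
Implicit Types a b c f n s t u v x y z I O G X Z A : M.

Definition subset a b : Prop := forall u, u ∈ a -> u ∈ b.
Definition disjoint a b : Prop := forall u, u ∈ a -> u ∉ b.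
Definition singleton x : M := pair x x.
Definition cup a b : M := union (pair a b).

(** Kuratowski pairs *)
Definition opair x y : M := pair (singleton x) (pair x y).

(** [f] is a function with domain [a] and all its values in the class [C]. *)
Definition is_function f a (C : M -> Prop) : Prop :=
  (forall p, p ∈ f -> exists u v, u ∈ a /\ C v /\ p = opair u v) /\
  (forall u, u ∈ a -> exists! v, opair u v ∈ f).

Definition equipotent a b : Prop :=
  exists f, is_function f a (fun v => v ∈ b) /\
    forall v, v ∈ b -> exists! u, opair u v ∈ f.

Definition finite a : Prop := exists n, n ∈ omega /\ equipotent n a.

Definition infinite a : Prop := ~ finite a.

Definition contains_finite_subsets X Z : Prop :=
  forall a, subset a X -> finite a -> a ∈ Z.

Definition union_closed Z : Prop :=
  forall a b, a ∈ Z -> b ∈ Z -> cup a b ∈ Z.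

Definition ideal X I : Prop :=
  subset I (power X) /\
  empty ∈ I /\
  (forall a b, b ∈ I -> subset a b -> a ∈ I) /\
  union_closed I.

Definition bornology X I : Prop := ideal X I /\ union I = X.

Definition sigma_ideal X I : Prop :=
  ideal X I /\
  forall t, is_function t omega (fun v => v ∈ I) ->
  forall c,
    (forall u, u ∈ c <-> exists n v, n ∈ omega /\ opair n v ∈ t /\ u ∈ v) ->
    c ∈ I.

(** A topological space is given by its underlying set and its class of open
    sets. *)

Definition G_delta (open : M -> Prop) G : Prop :=
  exists f, is_function f omega open /\
    forall u, u ∈ G <-> forall n O, n ∈ omega -> opair n O ∈ f -> u ∈ O.

Definition in_interior (open : M -> Prop) x G : Prop :=
  exists O, open O /\ x ∈ O /\ subset O G.

Definition P_point (S : M) (open : M -> Prop) x : Prop :=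
  x ∈ S /\ forall G, G_delta open G -> x ∈ G -> in_interior open x G.

Definition P_space (S : M) (open : M -> Prop) : Prop :=
  forall x, x ∈ S -> P_point S open x.

(** [V] is open in S_A(X,Z). *)
Definition tau X Z A (V : M) : Prop :=
  subset V A /\
  forall x, x ∈ V -> exists z, z ∈ Z /\ disjoint x z /\
    forall y, y ∈ A -> subset x y ->
      (forall u, u ∈ y -> u ∈ X /\ u ∉ z) -> y ∈ V.

End InternalNotions.

(* Main.v *)
(** Every statement about P-points below comes from transporting a sequence of
    open sets along [y ↦ y ∪ x] or [y ↦ y \ x].  If [O n] are open around [x],
    the sets [{y | y ∪ x ∈ O n}] are open around the empty set, and a basic
    neighbourhood [[∅, z]] contained in all of them yields [[x, z \ x]] inside
    all the [O n]; the preimages under [y ↦ y \ x] give the other direction.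
    No [z] is ever chosen for each [n], so choice is not needed.  For the
    σ-ideal property, [∅] being a P-point is applied to the sets
    [{y | y ∩ t n = ∅}], whose intersection is tested on singletons. *)

From Stdlib Require Import Classical.
Require Import Defs.

(** * Kuratowski pairs in the language of set theory *)

Definition fIff (p q : formula) : formula := fAnd (fImp p q) (fImp q p).

Definition fPair (c a b : nat) : formula :=
  fAll (fIff (fMem 0 (S c)) (fOr (fEq 0 (S a)) (fEq 0 (S b)))).

(** The outer witness is the unordered pair and the inner one the singleton; the two quantifiers
    shift the parameters by two. *)
Definition fOpair (c a b : nat) : formula :=
  fEx (fEx (fAnd (fPair 0 (S (S a)) (S (S a)))
    (fAnd (fPair 1 (S (S a)) (S (S b))) (fPair (S (S c)) 0 1)))).

Section Model.

Set Implicit Arguments.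
Unset Strict Implicit.

Variable M : zf_model.
Implicit Types a b c f n s t u v w x y z B G O V X Z A : M.

Lemma pair_unique a b c :
  (forall u, u ∈ c <-> u = a \/ u = b) <-> c = pair a b.
Proof.
split.
- intros H. apply extensionality. intros u. rewrite H, pair_spec. reflexivity.
- intros ->. apply pair_spec.
Qed.

Lemma sat_fPair (e : nat -> M) (c a b : nat) :
  sat (@mem M) e (fPair c a b) <-> e c = pair (e a) (e b).
Proof. exact (pair_unique (e a) (e b) (e c)). Qed.

Lemma sat_fOpair (e : nat -> M) (c a b : nat) :
  sat (@mem M) e (fOpair c a b) <-> e c = opair (e a) (e b).
Proof.
unfold fOpair. split.
- intros (v & w & Hw & Hv & H).
  apply sat_fPair in Hw, Hv, H. simpl in Hw, Hv, H.
  rewrite H, Hv, Hw. reflexivity.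
- intros H. exists (pair (e a) (e b)), (singleton (e a)).
  split; [|split]; apply sat_fPair; [reflexivity | reflexivity | exact H].
Qed.

(** * Elementary set operations in the model *)

Lemma singleton_spec x u : u ∈ singleton x <-> u = x.
Proof. unfold singleton. rewrite pair_spec. tauto. Qed.

Lemma cup_spec a b u : u ∈ cup a b <-> u ∈ a \/ u ∈ b.
Proof.
unfold cup. rewrite union_spec. split.
- intros (w & Hw & Hu). apply pair_spec in Hw as [-> | ->]; auto.
- intros [H | H]; [exists a | exists b]; rewrite pair_spec; auto.
Qed.

Lemma diff_exists a b : exists c, forall u, u ∈ c <-> u ∈ a /\ u ∉ b.
Proof. exact (separation (fImp (fMem 0 1) fBot) (fun _ => b) a). Qed.

Lemma pair_inj_r a b c : pair a b = pair a c -> b = c.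
Proof.
intros H.
assert (Hb : b ∈ pair a c) by (rewrite <- H; apply pair_spec; auto).
assert (Hc : c ∈ pair a b) by (rewrite H; apply pair_spec; auto).
apply pair_spec in Hb, Hc. intuition congruence.
Qed.

Lemma opair_inj a b c d : opair a b = @opair M c d -> a = c /\ b = d.
Proof.
intros H.
assert (Hac : a = c).
{ assert (Hc : singleton c ∈ opair a b) by (rewrite H; apply pair_spec; auto).
  apply pair_spec in Hc as [Hc | Hc].
  - symmetry. apply singleton_spec. rewrite <- Hc. apply singleton_spec. reflexivity.
  - apply singleton_spec. rewrite Hc. apply pair_spec. auto. }
subst c. split; [reflexivity |].
apply pair_inj_r in H. exact (pair_inj_r H).
Qed.

(** The indices of the variables are arguments of the formula, so that it can
    be placed under quantifiers without renaming. *)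
Definition definable (Q : M -> M -> M -> Prop) : Prop :=
  exists q : nat -> nat -> nat -> formula, forall e i j k,
    sat (@mem M) e (q i j k) <-> Q (e i) (e j) (e k).

(** * Sequences and intersections of definable sets *)

(** Replacement is applied to [f] itself, sending the pair of [n] and [O] to that of [n] and [B].
    Since [O] determines [B] by extensionality, nothing is chosen. Only [Q] has to be first-order;
    [C] and [D] may be arbitrary classes. *)
Lemma function_comprehension (Q : M -> M -> M -> Prop) (C D : M -> Prop) f a A w :
  definable Q -> is_function f a C ->
  (forall O B, C O -> (forall y, y ∈ B <-> y ∈ A /\ Q w y O) -> D B) ->
  exists g, is_function g a D /\
    forall n B, opair n B ∈ g <-> exists O, opair n O ∈ f /\
      forall y, y ∈ B <-> y ∈ A /\ Q w y O.
Proof.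
intros [q Hq] [Hf Hex] HD.
set (env := scons A (fun _ : nat => w)).
(* After the quantifiers over n, O, B and y, the variables are
   y = 0, B = 1, O = 2, n = 3, the argument = 4, the value = 5, A = 6, w = 7. *)
set (F := fEx (fEx (fEx (fAnd (fOpair 3 2 1) (fAnd (fOpair 4 2 0)
  (fAll (fIff (fMem 0 1) (fAnd (fMem 0 6) (q 7 0 2))))))))).
assert (HF : forall p v, sat (@mem M) (scons p (scons v env)) F <->
  exists n O B, p = opair n O /\ v = opair n B /\
    forall y, y ∈ B <-> y ∈ A /\ Q w y O).
{ intros p v. split.
  - intros (n & O & B & H1 & H2 & H3).
    apply sat_fOpair in H1, H2. exists n, O, B.
    split; [exact H1 | split; [exact H2 |]]. intros y.
    specialize (H3 y). simpl in H3. rewrite Hq in H3. exact H3.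
  - intros (n & O & B & H1 & H2 & H3). exists n, O, B.
    split; [apply sat_fOpair; exact H1 |].
    split; [apply sat_fOpair; exact H2 |]. intros y.
    specialize (H3 y). simpl. rewrite Hq. exact H3. }
destruct (@replacement M F env f) as [g Hg].
{ intros p v v' _ H H'. apply HF in H, H'.
  destruct H as (n & O & B & -> & -> & HB).
  destruct H' as (n' & O' & B' & E & -> & HB').
  apply opair_inj in E as [<- <-]. f_equal. apply extensionality.
  intros u. rewrite HB, HB'. reflexivity. }
assert (Hspec : forall n B, opair n B ∈ g <-> exists O, opair n O ∈ f /\
  forall y, y ∈ B <-> y ∈ A /\ Q w y O).
{ intros n B. rewrite Hg. split.
  - intros (p & Hp & H). apply HF in H as (n' & O & B' & -> & E & HB).
    apply opair_inj in E as [<- <-]. eauto.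
  - intros (O & HO & HB). exists (opair n O). split; [exact HO |].
    apply HF. eauto 6. }
exists g. split; [split | exact Hspec].
- intros p Hp. apply Hg in Hp as (r & Hr & H).
  apply HF in H as (n & O & B & -> & -> & HB).
  destruct (Hf _ Hr) as (n' & O' & Hn & HO & E).
  apply opair_inj in E as [<- <-]. eauto 6.
- intros n Hn. destruct (Hex n Hn) as (O & HO & Huniq).
  destruct (separation (q 2 0 1) (scons O (fun _ => w)) A) as [B HB].
  assert (HB' : forall y, y ∈ B <-> y ∈ A /\ Q w y O).
  { intros y. rewrite HB, Hq. reflexivity. }
  exists B. split; [apply Hspec; eauto |].
  intros B' H. apply Hspec in H as (O' & HO' & HB'').
  apply Huniq in HO' as <-. apply extensionality. intros u.
  rewrite HB', HB''. reflexivity.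
Qed.

Lemma sequence_intersection_exists f (C : M -> Prop) A :
  is_function f omega C -> (forall O, C O -> subset O A) ->
  exists G, forall u, u ∈ G <->
    forall n O, n ∈ omega -> opair n O ∈ f -> u ∈ O.
Proof.
intros [Hf Hex] HC.
(* The formula says that every member of [f] of the form [opair n O] has [u ∈ O]; that [n ∈ omega]
   then follows from [f] being a function on [omega]. *)
destruct (@separation M
  (fAll (fImp (fMem 0 2) (fAll (fAll (fImp (fOpair 2 1 0) (fMem 3 0))))))
  (fun _ => f) A) as [G HG].
exists G. intros u. rewrite HG. split.
- intros [_ H] n O _ HO. apply (H (opair n O) HO n O).
  apply sat_fOpair. reflexivity.
- intros H. split.
  (* The value at index zero is a subset of [A], which places [u] in [A]. *)
  + destruct (Hex empty (@omega_zero M)) as (O & HO & _).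
    destruct (Hf _ HO) as (n & O' & Hn & HO' & E).
    apply opair_inj in E as [_ <-].
    apply (HC O HO'). exact (H _ _ (@omega_zero M) HO).
  + intros p Hp n O E. apply sat_fOpair in E. simpl in E, Hp. subst p.
    apply (H n O); [| exact Hp].
    destruct (Hf _ Hp) as (n' & O' & Hn & _ & E).
    apply opair_inj in E as [-> _]. exact Hn.
Qed.

(** The sets of [y ∈ A] with [Q w y O], for [O] a value of [f], are open and contain [x], so one
    neighbourhood of [x] lies in all of them. The class [C] is left free because [f] may also be a
    sequence of members of the ideal. *)
Lemma P_point_comprehension (open C : M -> Prop) (Q : M -> M -> M -> Prop) A x f w :
  P_point A open x -> (forall O, open O -> subset O A) ->
  definable Q -> is_function f omega C ->
  (forall O B, C O -> (forall y, y ∈ B <-> y ∈ A /\ Q w y O) -> open B) ->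
  (forall n O, opair n O ∈ f -> Q w x O) ->
  exists V, open V /\ x ∈ V /\
    forall y n O, y ∈ V -> opair n O ∈ f -> Q w y O.
Proof.
intros [HxA HP] Hsub HQ Hf Hopen Hx.
destruct (function_comprehension HQ Hf Hopen) as (g & Hg & Hspec).
destruct (sequence_intersection_exists Hg Hsub) as [G HG].
destruct (HP G) as (V & HV & HxV & HVG).
- exists g. split; assumption.
- apply HG. intros n B _ HB. apply Hspec in HB as (O & HO & HB).
  apply HB. eauto.
- exists V. split; [exact HV | split; [exact HxV |]].
  intros y n O Hy HO.
  destruct Hf as [Hf Huniq], (Hf _ HO) as (n' & O' & Hn & _ & E).
  apply opair_inj in E as [<- <-].
  destruct Hg as [_ Hg], (Hg n Hn) as (B & HB & _).
  pose proof (proj1 (HG y) (HVG y Hy) n B Hn HB) as HyB.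
  (* [B] comes from some value [O'] of [f] at [n], which uniqueness identifies with [O]. *)
  apply Hspec in HB as (O' & HO' & HB).
  destruct (Huniq n Hn) as (O0 & _ & HU).
  rewrite <- (HU _ HO), (HU _ HO'). apply HB. exact HyB.
Qed.

(** * First-order definability of the relations being transported *)

Lemma definable_disjoint : definable (fun _ y t => disjoint y t).
Proof.
exists (fun _ j k => fAll (fImp (fMem 0 (S j)) (fImp (fMem 0 (S k)) fBot))).
reflexivity.
Qed.

(** [cup] is not a symbol of [formula], so the union is described by its members. *)
Lemma definable_cup_mem :
  definable (fun x y O => exists v, v ∈ O /\
    forall u, u ∈ v <-> u ∈ y \/ u ∈ x).
Proof.
exists (fun i j k => fEx (fAnd (fMem 0 (S k)) (fAll (fIff (fMem 0 1)
  (fOr (fMem 0 (S (S j))) (fMem 0 (S (S i)))))))).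
reflexivity.
Qed.

Lemma definable_diff_mem :
  definable (fun x y O => subset x y /\ exists v, v ∈ O /\
    forall u, u ∈ v <-> u ∈ y /\ u ∉ x).
Proof.
exists (fun i j k => fAnd (fAll (fImp (fMem 0 (S i)) (fMem 0 (S j))))
  (fEx (fAnd (fMem 0 (S k)) (fAll (fIff (fMem 0 1)
    (fAnd (fMem 0 (S (S j))) (fImp (fMem 0 (S (S i))) fBot))))))).
reflexivity.
Qed.

(** * Basic open sets *)

Lemma tau_subset X Z A V : tau X Z A V -> subset V A.
Proof. intros [H _]. exact H. Qed.

(** The same [z] witnesses openness at every member [y], because raising the lower bound from [x] to
    [y] only shrinks the interval. *)
Lemma tau_basic X Z A x z : z ∈ Z -> disjoint x z -> subset x X -> x ∈ A ->
  exists V, tau X Z A V /\ forall y, y ∈ V <->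
    y ∈ A /\ subset x y /\ forall u, u ∈ y -> u ∈ X /\ u ∉ z.
Proof.
intros Hz Hxz HxX HxA.
(* Under the inner quantifier the variables are u = 0, y = 1, x = 2, X = 3, z = 4. *)
destruct (@separation M (fAnd
  (fAll (fImp (fMem 0 2) (fMem 0 1)))
  (fAll (fImp (fMem 0 1) (fAnd (fMem 0 3) (fImp (fMem 0 4) fBot)))))
  (scons x (scons X (fun _ => z))) A) as [V HV].
assert (HV' : forall y, y ∈ V <->
    y ∈ A /\ subset x y /\ forall u, u ∈ y -> u ∈ X /\ u ∉ z) by exact HV.
exists V. split; [split | exact HV'].
- intros y Hy. apply HV' in Hy. tauto.
- intros y Hy. apply HV' in Hy as (_ & Hxy & Hyz). exists z.
  split; [exact Hz | split; [intros u Hu; apply Hyz; exact Hu |]].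
  intros y' Hy' Hyy' Hy'z. apply HV'. unfold subset in *. auto.
Qed.

(** * Consequences of the existence of a P-point *)

(** The set [z] bounding a neighbourhood of the empty set that avoids every term of [t] must contain
    the whole union of [t]. *)
Lemma sigma_ideal_of_P_point_empty X Z A :
  ideal X Z -> (forall p, p ∈ X -> singleton p ∈ A) -> subset A (power X) ->
  P_point A (tau X Z A) empty -> sigma_ideal X Z.
Proof.
intros HZ HA1 HAX HP. split; [exact HZ |].
destruct HZ as (HZX & HZ0 & HZsub & HZU). intros t Ht c Hc.
destruct (P_point_comprehension (w := empty) HP (@tau_subset X Z A)
  definable_disjoint Ht) as (V & (HVA & HV) & H0V & HVt).
- intros s B Hs HB. split; [intros y Hy; apply HB in Hy as [Hy _]; exact Hy |].
  intros y Hy. apply HB in Hy as [_ Hy]. exists s.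
  split; [exact Hs | split; [exact Hy |]].
  intros y' Hy' _ Hy's. apply HB. split; [exact Hy' |].
  intros u Hu. apply Hy's. exact Hu.
- intros n s _ u Hu. destruct (empty_spec Hu).
- destruct (HV empty H0V) as (z & Hz & _ & HzV).
  apply (HZsub c z Hz). intros u Hu.
  apply Hc in Hu as (n & s & Hn & Hs & Hus).
  assert (HuX : u ∈ X).
  { destruct Ht as [Ht _], (Ht _ Hs) as (n' & s' & _ & Hs' & E).
    apply opair_inj in E as [_ <-].
    apply HZX in Hs'. exact (proj1 (power_spec _ _) Hs' u Hus). }
  (* If [u] were outside [z], its singleton would lie in [V] and yet meet [s]. *)
  apply NNPP. intros Huz.
  assert (HuV : singleton u ∈ V).
  { apply HzV.
    - apply HA1. exact HuX.
    - intros v Hv. destruct (empty_spec Hv).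
    - intros v Hv. apply singleton_spec in Hv as ->. auto. }
  apply (HVt _ _ _ HuV Hs u); [apply singleton_spec; reflexivity | exact Hus].
Qed.

Lemma P_space_of_P_point_empty X Z A :
  ideal X Z -> ideal X A -> P_point A (tau X Z A) empty ->
  P_space A (tau X Z A).
Proof.
intros (_ & _ & HZsub & _) (HAX & _ & HAsub & HAU) HP x HxA.
split; [exact HxA |]. intros G (f & Hf & HG) HxG.
destruct (P_point_comprehension (w := x) HP (@tau_subset X Z A)
  definable_cup_mem Hf) as (V & (_ & HV) & H0V & HVf).
- intros O B [HOA HO] HB. split; [intros y Hy; apply HB in Hy as [Hy _]; exact Hy |].
  intros y Hy. apply HB in Hy as (HyA & v & Hv & Hvy).
  destruct (HO v Hv) as (z & Hz & Hvz & HzO). exists z.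
  split; [exact Hz | split; [intros u Hu; apply Hvz, Hvy; auto |]].
  intros y' Hy' Hyy' Hy'z. apply HB. split; [exact Hy' |].
  exists (cup y' x). split; [| apply cup_spec].
  apply HzO.
  + apply HAU; assumption.
  + intros u Hu. apply cup_spec. apply Hvy in Hu as [Hu | Hu]; auto.
  + intros u Hu. apply cup_spec in Hu as [Hu | Hu]; [auto |]. split.
    * apply HAX in HxA. exact (proj1 (power_spec _ _) HxA u Hu).
    * apply Hvz, Hvy. auto.
- intros n O HO. exists x. split.
  + destruct Hf as [Hf _], (Hf _ HO) as (n' & O' & Hn & _ & E).
    apply opair_inj in E as [<- <-]. exact (proj1 (HG x) HxG n O Hn HO).
  + intros u. split; [auto |]. intros [Hu | Hu]; [| exact Hu].
    destruct (empty_spec Hu).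
- destruct (HV empty H0V) as (z & Hz & _ & HzV).
  (* Removing [x] from [z] makes the basic neighbourhood of [x] legitimate. *)
  destruct (diff_exists z x) as [z' Hz'].
  destruct (@tau_basic X Z A x z') as (W & HW & HWspec).
  + apply (HZsub z' z Hz). intros u Hu. apply Hz'. exact Hu.
  + intros u Hu Huz. apply Hz' in Huz as [_ Huz]. auto.
  + apply HAX in HxA. exact (proj1 (power_spec _ _) HxA).
  + exact HxA.
  + exists W. split; [exact HW | split].
    * apply HWspec. split; [exact HxA | split; [intros u Hu; exact Hu |]].
      intros u Hu. split.
      -- apply HAX in HxA. exact (proj1 (power_spec _ _) HxA u Hu).
      -- intros Huz. apply Hz' in Huz as [_ Huz]. auto.
    * intros y Hy. apply HWspec in Hy as (HyA & Hxy & Hyz).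
      apply HG. intros n O Hn HO.
      (* The part of [y] outside [x] avoids all of [z], hence lies in [V]; adjoining [x] gives [y]
         back since [x] is a subset of [y]. *)
      destruct (diff_exists y x) as [d Hd].
      assert (HdV : d ∈ V).
      { apply HzV.
        - apply (HAsub d y HyA). intros u Hu. apply Hd. exact Hu.
        - intros u Hu. destruct (empty_spec Hu).
        - intros u Hu. apply Hd in Hu as [Huy Hux]. split; [apply Hyz; exact Huy |].
          intros Huz. apply (Hyz u Huy). apply Hz'. auto. }
      destruct (HVf _ _ _ HdV HO) as (v & Hv & Hvd).
      replace y with v; [exact Hv |]. apply extensionality. intros u.
      rewrite Hvd, Hd. split.
      -- intros [[Hu _] | Hu]; auto.
      -- intros Hu. destruct (classic (u ∈ x)); auto.
Qed.

(** Transport along removal of [x]. The inclusion of [A] in [Z] makes [x] a member of [Z], so a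
    neighbourhood of the empty set can be required to avoid [x]. *)
Lemma P_point_empty_of_P_point X Z A x :
  ideal X Z -> ideal X A -> subset A Z ->
  P_point A (tau X Z A) x -> P_point A (tau X Z A) empty.
Proof.
intros (HZX & _ & HZsub & HZU) (HAX & HA0 & HAsub & HAU) HAZ HP.
split; [exact HA0 |]. intros G (f & Hf & HG) H0G.
assert (HxA : x ∈ A) by apply HP.
destruct (P_point_comprehension (w := x) HP (@tau_subset X Z A)
  definable_diff_mem Hf) as (V & (_ & HV) & HxV & HVf).
- intros O B [HOA HO] HB. split; [intros y Hy; apply HB in Hy as [Hy _]; exact Hy |].
  intros y Hy. apply HB in Hy as (HyA & Hxy & v & Hv & Hvy).
  destruct (HO v Hv) as (z & Hz & Hvz & HzO).
  (* [z] is only known to avoid [y] minus [x], so its points in [x] are discarded. *)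
  destruct (diff_exists z x) as [z' Hz']. exists z'. split; [| split].
  + apply (HZsub z' z Hz). intros u Hu. apply Hz'. exact Hu.
  + intros u Hu Huz. apply Hz' in Huz as [Huz Hux].
    apply (Hvz u); [apply Hvy; auto | exact Huz].
  + intros y' Hy' Hyy' Hy'z. apply HB. split; [exact Hy' |].
    split; [intros u Hu; auto |].
    destruct (diff_exists y' x) as [d Hd]. exists d. split; [| exact Hd].
    apply HzO.
    * apply (HAsub d y' Hy'). intros u Hu. apply Hd. exact Hu.
    * intros u Hu. apply Hvy in Hu as [Hu Hux]. apply Hd. auto.
    * intros u Hu. apply Hd in Hu as [Hu Hux]. split; [apply Hy'z; exact Hu |].
      intros Huz. apply (Hy'z u Hu). apply Hz'. auto.
- intros n O HO. split; [intros u Hu; exact Hu |].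
  exists empty. split.
  + destruct Hf as [Hf _], (Hf _ HO) as (n' & O' & Hn & _ & E).
    apply opair_inj in E as [<- <-]. exact (proj1 (HG empty) H0G n O Hn HO).
  + intros u. split; [intros Hu; destruct (empty_spec Hu) | tauto].
- destruct (HV x HxV) as (z & Hz & Hxz & HzV).
  (* Members [y] of this neighbourhood are disjoint from [x], so removing [x] from [cup y x] returns
     [y]. *)
  destruct (@tau_basic X Z A empty (cup z x)) as (W & HW & HWspec).
  + auto.
  + intros u Hu. destruct (empty_spec Hu).
  + intros u Hu. destruct (empty_spec Hu).
  + exact HA0.
  + exists W. split; [exact HW | split].
    * apply HWspec. split; [exact HA0 |].
      split; intros u Hu; destruct (empty_spec Hu).
    * intros y Hy. apply HWspec in Hy as (HyA & _ & Hyz).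
      apply HG. intros n O Hn HO.
      assert (HyV : cup y x ∈ V).
      { apply HzV.
        - auto.
        - intros u Hu. apply cup_spec. auto.
        - intros u Hu. apply cup_spec in Hu as [Hu | Hu].
          + split; [apply Hyz; exact Hu |]. intros Huz.
            apply (Hyz u Hu), cup_spec. auto.
          + split; [| apply Hxz; exact Hu].
            apply HAX in HxA. exact (proj1 (power_spec _ _) HxA u Hu). }
      destruct (HVf _ _ _ HyV HO) as (_ & v & Hv & Hvd).
      replace y with v; [exact Hv |]. apply extensionality. intros u.
      rewrite Hvd, cup_spec. split; [tauto |].
      intros Hu. split; [auto |]. intros Hux.
      apply (Hyz u Hu), cup_spec. auto.
Qed.

(** With the complement of [x] as [z], the basic neighbourhood of [x] is reduced to the point [x]:
    the space is discrete. *)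
Lemma P_space_discrete X A :
  subset A (power X) -> P_space A (tau X (power X) A).
Proof.
intros HAX x HxA. split; [exact HxA |]. intros G _ HxG.
assert (HxX : subset x X).
{ apply HAX in HxA. exact (proj1 (power_spec _ _) HxA). }
destruct (diff_exists X x) as [z Hz].
assert (Hxz : disjoint x z).
{ intros u Hu Huz. apply Hz in Huz. tauto. }
destruct (@tau_basic X (power X) A x z) as (V & HV & HVspec); auto.
- apply power_spec. intros u Hu. apply Hz. exact Hu.
- exists V. split; [exact HV | split].
  + apply HVspec. split; [exact HxA | split; [intros u Hu; exact Hu |]].
    intros u Hu. split; auto.
  + intros y Hy. apply HVspec in Hy as (_ & Hxy & Hyz).
    replace y with x; [exact HxG |]. apply extensionality. intros u.
    split; [apply Hxy |]. intros Hu. apply NNPP. intros Hux.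
    apply (Hyz u Hu), Hz. split; [apply Hyz; exact Hu | exact Hux].
Qed.

Lemma ideal_power X : ideal X (power X).
Proof.
split; [intros u Hu; exact Hu |]. split; [| split].
- apply power_spec. intros u Hu. destruct (empty_spec Hu).
- intros a b Hb Hab. rewrite power_spec in *. unfold subset in Hab. auto.
- intros a b Ha Hb. rewrite power_spec in *. intros u Hu.
  apply cup_spec in Hu as [Hu | Hu]; auto.
Qed.

End Model.

Theorem theorem3p6 (M : zf_model) (X Z A : M)
  (HX : infinite X)
  (HZX : subset Z (power X))
  (HZU : union_closed Z)
  (HZF : contains_finite_subsets X Z)
  (HAX : subset A (power X))
  (HA0 : empty ∈ A)
  (HA1 : forall p : M, p ∈ X -> singleton p ∈ A) :
  (* (i) *)
  (bornology X Z -> P_space A (tau X Z A) -> sigma_ideal X Z)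
  /\
  (* (ii) *)
  (bornology X Z -> bornology X A -> subset A Z ->
     (P_space A (tau X Z A) <-> (exists x : M, P_point A (tau X Z A) x)) /\
     ((exists x : M, P_point A (tau X Z A) x) <-> P_point A (tau X Z A) empty))
  /\
  (* (iii) *)
  (Z = power X -> contains_finite_subsets X A -> P_space A (tau X Z A))
  /\
  (* (iv) *)
  (bornology X Z ->
     (P_space (power X) (tau X Z (power X)) <-> P_point (power X) (tau X Z (power X)) empty)).
Proof.
split; [| split; [| split]].
- intros [HZ _] HP. exact (sigma_ideal_of_P_point_empty HZ HA1 HAX (HP empty HA0)).
- intros [HZ _] [HA _] HAZ.
  assert (Hca : P_point A (tau X Z A) empty -> P_space A (tau X Z A))
    by exact (P_space_of_P_point_empty HZ HA).
  assert (Hbc : (exists x : M, P_point A (tau X Z A) x) ->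
    P_point A (tau X Z A) empty).
  { intros [x Hx]. exact (P_point_empty_of_P_point HZ HA HAZ Hx). }
  (* The implications from (a) and from (c) to (b) both exhibit [empty] as the P-point. *)
  split; split; [| auto | auto |]; intros H; exists empty; auto.
- intros -> _. exact (P_space_discrete HAX).
- intros [HZ _]. split.
  + intros H. apply H. apply ideal_power.
  (* The full power set is itself an ideal, so it can take the place of [A]. *)
  + exact (P_space_of_P_point_empty HZ (ideal_power X)).
Qed.
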